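(* Let $\mathcal G_\bullet=(\mathcal G_1\rightrightarrows\mathcal G_0)$ be a (coherent) Lie 2-group. There is another 2-representation of $\mathcal G_\bullet$, similar to the 2-representation on $\mathsf{Rep}^{\mathcal G_\bullet}$ recalled in the context but restricted to the subcategory $\mathsf{Rep}^{\mathcal G_\bullet}_{tr}$, that is, with $\mathsf{Rep}^{\mathcal G_\bullet}$ replaced by $\mathsf{Rep}^{\mathcal G_\bullet}_{tr}$ everywhere. More precisely, there is a 2-representation of $\mathcal G_\bullet$ with the following data. (i) Object level: the only object $*$ of the one-object bicategory $B\mathcal G_\bullet$ maps to $\mathsf{Rep}^{\mathcal G_\bullet}_{tr}$. (ii) 1-morphism level: $F:\mathcal G_0\to\mathrm{Fun}(\mathsf{Rep}^{\mathcal G_\bullet}_{tr},\mathsf{Rep}^{\mathcal G_\bullet}_{tr})_0$, $g\mapsto F_g$, is defined as follows: for all $x,y\in\mathcal G_0$, any $(x\xrightarrow{b}y)\in\mathcal G_1$, any object $\rho$ of $\mathsf{Rep}^{\mathcal G_\bullet}_{tr}$, where $V$ denotes the single vector space that is the value of $\rho$ on every object of $\mathcal G_0$, and any morphism $f:\rho\Rightarrow\rho'$ in $\mathsf{Rep}^{\mathcal G_\bullet}_{tr}$, $$F_g(\rho):\ x\mapsto V,\quad (x\xrightarrow{b}y)\mapsto\big(V\xrightarrow{\rho(b\cdot_h1_g)}V\big),\qquad F_g(\rho\overset{f}{\Rightarrow}\rho')=\big(F_g(\rho)\xrightarrow{F_g(f)=f}F_g(\rho')\big).$$ (iii) 2-morphism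 level: $F:\mathcal G_1\to\mathrm{Fun}(\mathsf{Rep}^{\mathcal G_\bullet}_{tr},\mathsf{Rep}^{\mathcal G_\bullet}_{tr})_1$, $(g_0\xrightarrow{g_1}g_0')\mapsto F_{g_1}$, where $$F_{g_1}(\rho)_x:F_{g_0}(\rho)(x)\to F_{g_0'}(\rho)(x),\qquad v\mapsto\rho(1_x\cdot_hg_1)(v),\quad\forall v\in F_{g_0}(\rho)(x).$$
   Context: $k$ is a field of characteristic zero (typically $\mathbb R$ or $\mathbb C$). A coherent Lie 2-group $\mathcal G_\bullet=(\mathcal G_1\rightrightarrows\mathcal G_0)$ is a group object in the bicategory of Lie groupoids: a Lie groupoid with a multiplication $m:\mathcal G_\bullet\times\mathcal G_\bullet\to\mathcal G_\bullet$ and a unit $u:*\to\mathcal G_\bullet$ such that $(\mathrm{pr}_1,m)$ is an equivalence, together with invertible 2-morphisms $a:m\circ(m\times1)\Rightarrow m\circ(1\times m)$, $l:m\circ(u\times1)\Rightarrow1$, $r:m\circ(1\times u)\Rightarrow1$ satisfying the pentagon and triangle identities. Write $x\circ_hg=m(x,g)$ on objects, $b\cdot_hc=m(b,c)$ on arrows, and $1_g$ for the identity arrow of $g$. $B\mathcal G_\bullet$ is the delooping, i.e. the bicategory with a single object $*$, hom-category $\mathcal G_\bullet$ and horizontal composition $m$. $2\mathsf{Vect}$ is the strict 2-category of $k$-prelinear categories (hom-sets are $k$-vector spaces, composition is $k$-bilinear), $k$-linear functors and natural transformations. A 2-representation of $\mathcal G_\bullet$ is a pseudofunctor $B\mathcal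 G_\bullet\to2\mathsf{Vect}$. $\mathrm{Fun}(-,-)_0$ denotes the set of functors and $\mathrm{Fun}(-,-)_1$ the set of natural transformations. $\mathsf{Rep}^{\mathcal G_\bullet}$ is the category of representations of the underlying Lie groupoid of $\mathcal G_\bullet$: objects are vector bundles $V\to\mathcal G_0$ with a Lie groupoid morphism $\rho$ from $\mathcal G_\bullet$ to the groupoid of linear isomorphisms between the fibres of $V$ (write $\rho(x)=V_x$ for the fibre at $x$); morphisms are $\mathcal G_\bullet$-equivariant bundle maps, viewed as natural transformations $\rho\Rightarrow\rho'$. $\mathsf{Rep}^{\mathcal G_\bullet}_{tr}\subset\mathsf{Rep}^{\mathcal G_\bullet}$ is the full subcategory consisting of trivial vector bundles: each of its objects $\rho$ comes with a trivial bundle of the form $V\times\mathcal G_0$ with $V$ a fixed vector space. The 2-representation on $\mathsf{Rep}^{\mathcal G_\bullet}$ referred to in the claim sends $*$ to $\mathsf{Rep}^{\mathcal G_\bullet}$; sends $g\in\mathcal G_0$ to the functor $F_g$ with $F_g(\rho)(x)=\rho(x\circ_hg)=V_{x\circ_hg}$, $F_g(\rho)(x\xrightarrow{b}y)=\big(V_{x\circ_hg}\xrightarrow{\rho(b\cdot_h1_g)}V_{y\circ_hg}\big)$ and $F_g(f)_x=f_{x\circ_hg}$; and sends $g_1:g_0\to g_0'$ to the natural transformation $F_{g_1}$ with $F_{g_1}(\rho)_x:v\mapsto\rho(1_x\cdot_hg_1)(v)$. Its structure isomorphisms are $F_{g}\circ F_{\hat g}\Rightarrow F_{g\circ_h\hat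 g}$, given at $\rho$ and $x$ by $\rho(a_{x,g,\hat g})$, and $\mathrm{id}\Rightarrow F_{I}$ (with $I$ the unit object), given at $\rho$ and $x$ by $\rho(r_x)^{-1}$.
   Formalization: The formula F_g(f)=f fails for general f (F_g(f) need not be equivariant), so it is read as F_g(f)_x = f_{x∘_h g}, as for Rep, with F_g(f)=f literally when f is constant in x; k is taken to be ℝ or ℂ so that smooth vector bundles make sense. *)

(* Defs.v *)
From HB Require Import structures.
From mathcomp Require Import all_boot all_order all_algebra all_field.
From mathcomp Require Import all_classical all_reals all_analysis.

Set Implicit Arguments.
Unset Strict Implicit.
Unset Printing Implicit Defensive.
Import Order.TTheory GRing.Theory Num.Theory numFieldNormedType.Exports.
Local Open Scope classical_set_scope.
Local Open Scope ring_scope.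

Section SmoothMaps.
Context {R : realType}.

(* C^j on the open set U, by iterated directional derivatives. *)
Fixpoint Ck (n : nat) (W : normedModType R) (j : nat)
    (U : set 'rV[R]_n) (f : 'rV[R]_n -> W) : Prop :=
  if j is i.+1 then
    (forall x, U x -> differentiable f x) /\
    (forall v, Ck i U (fun x => 'd f x v))
  else forall x, U x -> {for x, continuous f}.

Definition smooth_on (n : nat) (W : normedModType R)
    (U : set 'rV[R]_n) (f : 'rV[R]_n -> W) : Prop :=
  forall j, Ck j U f.

(* cmap and cinv are total, but only matter on cdom and cimg; that they are
   inverse homeomorphisms there is required in is_chart. *)
Record chart (M : Type) (n : nat) := Chart {
  cdom : set M;
  cimg : set 'rV[R]_n;
  cmap : M -> 'rV[R]_n;
  cinv : 'rV[R]_n -> M }.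

End SmoothMaps.
Arguments chart R M n : clear implicits.

(* An atlas without its axioms, so that products are pure data. *)
Record smooth_space (R : realType) := SmoothSpace {
  spoint :> topologicalType;
  sdim : nat;
  satlas : set (chart R spoint sdim) }.

Section Manifolds.
Context {R : realType}.
Implicit Types M N : smooth_space R.

Record is_chart (M : topologicalType) (n : nat) (c : chart R M n) : Prop := {
  cdom_open : open (cdom c);
  cimg_open : open (cimg c);
  cmap_img : forall x, cdom c x -> cimg c (cmap c x);
  cinv_dom : forall y, cimg c y -> cdom c (cinv c y);
  cmapK : forall x, cdom c x -> cinv c (cmap c x) = x;
  cinvK : forall y, cimg c y -> cmap c (cinv c y) = y;
  cmap_continuous : forall x, cdom c x -> {for x, continuous (cmap c)};
  cinv_continuous : forall y, cimg c y -> {for y, continuous (cinv c)} }.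

Record is_manifold M : Prop := {
  manifold_hausdorff : hausdorff_space M;
  manifold_second_countable : @second_countable M;
  manifold_chart : forall c : chart R M (sdim M), satlas c -> is_chart c;
  manifold_cover : forall x : M, exists2 c, satlas c & cdom c x;
  manifold_compat : forall c d : chart R M (sdim M), satlas c -> satlas d ->
    smooth_on [set y | cimg c y /\ cdom d (cinv c y)] (cmap d \o cinv c) }.

Definition prod_chart (M N : Type) (m n : nat)
    (c : chart R M m) (d : chart R N n) : chart R (M * N)%type (m + n) :=
  Chart [set p | cdom c p.1 /\ cdom d p.2]
        [set y | cimg c (lsubmx y) /\ cimg d (rsubmx y)]
        (fun p => row_mx (cmap c p.1) (cmap d p.2))
        (fun y => (cinv c (lsubmx y), cinv d (rsubmx y))).

Definition sprod M N : smooth_space R :=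
  @SmoothSpace R (M * N)%type (sdim M + sdim N)
    [set e | exists c d, [/\ satlas c, satlas d & e = prod_chart c d]].

(* Smoothness of f on the open subset A of M. *)
Definition smooth_map_on M N (A : set M) (f : M -> N) : Prop :=
  (forall x, A x -> {for x, continuous f}) /\
  (forall (c : chart R M (sdim M)) (d : chart R N (sdim N)),
    satlas c -> satlas d ->
    smooth_on
      [set y | [/\ cimg c y, A (cinv c y) & cdom d (f (cinv c y))]]
      (cmap d \o f \o cinv c)).

Definition smooth_map M N (f : M -> N) : Prop := smooth_map_on setT f.

(* Smoothness on an arbitrary subset S: f has local smooth extensions.  For S
   an embedded submanifold, this is smoothness for the induced structure. *)
Definition smooth_map_within M N (S : set M) (f : M -> N) : Prop :=
  forall x, S x -> exists (A : set M) (g : M -> N),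
    [/\ open A, A x, smooth_map_on A g &
        forall y, A y -> S y -> g y = f y].

Definition submersion M N (f : M -> N) : Prop :=
  smooth_map f /\
  forall (x : M) (c : chart R M (sdim M)) (d : chart R N (sdim N)),
    satlas c -> satlas d -> cdom c x -> cdom d (f x) ->
    forall w, exists v, 'd (cmap d \o f \o cinv c) (cmap c x) v = w.

Definition smooth_fun M (h : M -> R) : Prop :=
  forall c : chart R M (sdim M), satlas c -> smooth_on (cimg c) (h \o cinv c).

End Manifolds.

(* gcomp c b is the composite "c after b"; it is only meaningful when
   gsrc c = gtgt b. *)
Record groupoid (R : realType) := Groupoid {
  gob : smooth_space R;
  garr : smooth_space R;
  gsrc : garr -> gob;
  gtgt : garr -> gob;
  gid : gob -> garr;
  gcomp : garr -> garr -> garr;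
  ginv : garr -> garr }.
Arguments gid {R g}.
Arguments gcomp {R g}.
Arguments ginv {R g}.

Section LieGroupoids.
Context {R : realType}.

Record is_lie_groupoid (G : groupoid R) : Prop := {
  gob_manifold : is_manifold (gob G);
  garr_manifold : is_manifold (garr G);
  gsrc_submersion : submersion (@gsrc R G);
  gtgt_submersion : submersion (@gtgt R G);
  gid_smooth : smooth_map (@gid R G);
  gcomp_smooth : @smooth_map_within R (sprod (garr G) (garr G)) (garr G)
    [set p | gsrc p.1 = gtgt p.2] (fun p => gcomp p.1 p.2);
  ginv_smooth : smooth_map (@ginv R G);
  gsrc_id : forall x : gob G, gsrc (gid x) = x;
  gtgt_id : forall x : gob G, gtgt (gid x) = x;
  gsrc_comp : forall c b : garr G, gsrc c = gtgt b -> gsrc (gcomp c b) = gsrc b;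
  gtgt_comp : forall c b : garr G, gsrc c = gtgt b -> gtgt (gcomp c b) = gtgt c;
  gcompA : forall d c b : garr G, gsrc d = gtgt c -> gsrc c = gtgt b ->
    gcomp d (gcomp c b) = gcomp (gcomp d c) b;
  gcomp1l : forall b : garr G, gcomp (gid (gtgt b)) b = b;
  gcomp1r : forall b : garr G, gcomp b (gid (gsrc b)) = b;
  gsrc_inv : forall b : garr G, gsrc (ginv b) = gtgt b;
  gtgt_inv : forall b : garr G, gtgt (ginv b) = gsrc b;
  gcompVl : forall b : garr G, gcomp (ginv b) b = gid (gsrc b);
  gcompVr : forall b : garr G, gcomp b (ginv b) = gid (gtgt b) }.

Record lie_groupoid := LieGroupoid {
  lgpd :> groupoid R;
  lgpdP : is_lie_groupoid lgpd }.

Definition gprod (G H : groupoid R) : groupoid R :=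
  @Groupoid R (sprod (gob G) (gob H)) (sprod (garr G) (garr H))
    (fun b => (gsrc b.1, gsrc b.2)) (fun b => (gtgt b.1, gtgt b.2))
    (fun x => (gid x.1, gid x.2))
    (fun c b => (gcomp c.1 b.1, gcomp c.2 b.2))
    (fun b => (ginv b.1, ginv b.2)).

Record gmap (G H : groupoid R) := GMap {
  gmap0 : gob G -> gob H;
  gmap1 : garr G -> garr H }.

Definition gmap_id (G : groupoid R) : gmap G G := GMap id id.

Definition gmap_comp (G H K : groupoid R) (F' : gmap H K) (F : gmap G H) :
    gmap G K :=
  GMap (gmap0 F' \o gmap0 F) (gmap1 F' \o gmap1 F).

Record is_smooth_functor (G H : groupoid R) (F : gmap G H) : Prop := {
  gmap0_smooth : smooth_map (gmap0 F);
  gmap1_smooth : smooth_map (gmap1 F);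
  gmap_src : forall b, gsrc (gmap1 F b) = gmap0 F (gsrc b);
  gmap_tgt : forall b, gtgt (gmap1 F b) = gmap0 F (gtgt b);
  gmap_gid : forall x, gmap1 F (gid x) = gid (gmap0 F x);
  gmap_gcomp : forall c b, gsrc c = gtgt b ->
    gmap1 F (gcomp c b) = gcomp (gmap1 F c) (gmap1 F b) }.

(* Between Lie groupoids such an eta is automatically invertible. *)
Record is_smooth_nat (G H : groupoid R) (F F' : gmap G H)
    (eta : gob G -> garr H) : Prop := {
  gnat_smooth : smooth_map eta;
  gnat_src : forall x, gsrc (eta x) = gmap0 F x;
  gnat_tgt : forall x, gtgt (eta x) = gmap0 F' x;
  gnat_naturality : forall b,
    gcomp (eta (gtgt b)) (gmap1 F b) = gcomp (gmap1 F' b) (eta (gsrc b)) }.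

(* Internal equivalence in the 2-category of Lie groupoids. *)
Definition is_smooth_equivalence (G H : groupoid R) (F : gmap G H) : Prop :=
  is_smooth_functor F /\
  exists K : gmap H G, [/\ is_smooth_functor K,
    exists eta, is_smooth_nat (gmap_comp F K) (gmap_id H) eta &
    exists eta, is_smooth_nat (gmap_comp K F) (gmap_id G) eta].

End LieGroupoids.
Arguments lie_groupoid R : clear implicits.

Record mult_data (R : realType) := MultData {
  mgpd :> lie_groupoid R;
  mmul : gmap (gprod mgpd mgpd) mgpd;
  munit : gob mgpd;
  massoc : gob mgpd -> gob mgpd -> gob mgpd -> garr mgpd;
  mlunit : gob mgpd -> garr mgpd;
  mrunit : gob mgpd -> garr mgpd }.
Arguments munit {R m}.
Arguments massoc {R m}.
Arguments mlunit {R m}.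
Arguments mrunit {R m}.

Definition hob (R : realType) (G : mult_data R) (x g : gob G) : gob G :=
  gmap0 (mmul G) (x, g).
Definition harr (R : realType) (G : mult_data R) (b c : garr G) : garr G :=
  gmap1 (mmul G) (b, c).

Notation "x \oh g" := (hob x g) (at level 40, left associativity).
Notation "b \.h c" := (harr b c) (at level 40, left associativity).

Section LieTwoGroups.
Context {R : realType}.

(* The unit functor from the one-point groupoid is the object munit. *)
Record is_lie_2group (G : mult_data R) : Prop := {
  l2_mul : is_smooth_functor (mmul G);
  l2_shear : @is_smooth_equivalence R (gprod G G) (gprod G G)
    (@GMap R (gprod G G) (gprod G G)
      (fun x => (x.1, x.1 \oh x.2)) (fun b => (b.1, b.1 \.h b.2)));
  l2_assoc : @is_smooth_nat R (gprod (gprod G G) G) G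
    (@GMap R (gprod (gprod G G) G) G
      (fun x => (x.1.1 \oh x.1.2) \oh x.2) (fun b => (b.1.1 \.h b.1.2) \.h b.2))
    (@GMap R (gprod (gprod G G) G) G
      (fun x => x.1.1 \oh (x.1.2 \oh x.2)) (fun b => b.1.1 \.h (b.1.2 \.h b.2)))
    (fun x => massoc x.1.1 x.1.2 x.2);
  l2_lunit : @is_smooth_nat R G G
    (@GMap R G G (fun x => munit \oh x) (fun b => gid munit \.h b))
    (gmap_id G) mlunit;
  l2_runit : @is_smooth_nat R G G
    (@GMap R G G (fun x => x \oh munit) (fun b => b \.h gid munit))
    (gmap_id G) mrunit;
  l2_pentagon : forall w x y z : gob G,
    gcomp (massoc w x (y \oh z)) (massoc (w \oh x) y z) =
    gcomp (gid w \.h massoc x y z)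
          (gcomp (massoc w (x \oh y) z) (massoc w x y \.h gid z));
  l2_triangle : forall x y : gob G,
    gcomp (gid x \.h mlunit y) (massoc x munit y) = mrunit x \.h gid y }.

End LieTwoGroups.

Record lie_2group (R : realType) := Lie2Group {
  l2data :> mult_data R;
  l2P : is_lie_2group l2data }.

Record bicategory := Bicategory {
  cell0 :> Type;
  cell1 : cell0 -> cell0 -> Type;
  cell2 : forall x y, cell1 x y -> cell1 x y -> Type;
  id2 : forall x y (f : cell1 x y), cell2 f f;
  vcomp : forall x y (f g h : cell1 x y), cell2 g h -> cell2 f g -> cell2 f h;
  id1 : forall x, cell1 x x;
  comp1 : forall x y z, cell1 y z -> cell1 x y -> cell1 x z;
  hcomp : forall x y z (g g' : cell1 y z) (f f' : cell1 x y),
    cell2 g g' -> cell2 f f' -> cell2 (comp1 g f) (comp1 g' f');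
  assoc : forall w x y z (h : cell1 y z) (g : cell1 x y) (f : cell1 w x),
    cell2 (comp1 (comp1 h g) f) (comp1 h (comp1 g f));
  lunit : forall x y (f : cell1 x y), cell2 (comp1 (id1 y) f) f;
  runit : forall x y (f : cell1 x y), cell2 (comp1 f (id1 x)) f;
  vcompA : forall x y (f g h i : cell1 x y)
    (c : cell2 h i) (b : cell2 g h) (a : cell2 f g),
    vcomp c (vcomp b a) = vcomp (vcomp c b) a;
  vcomp1l : forall x y (f g : cell1 x y) (a : cell2 f g), vcomp (id2 g) a = a;
  vcomp1r : forall x y (f g : cell1 x y) (a : cell2 f g), vcomp a (id2 f) = a;
  hcomp_id2 : forall x y z (g : cell1 y z) (f : cell1 x y),
    hcomp (id2 g) (id2 f) = id2 (comp1 g f);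
  interchange : forall x y z (g g' g'' : cell1 y z) (f f' f'' : cell1 x y)
    (b' : cell2 g' g'') (b : cell2 g g') (a' : cell2 f' f'') (a : cell2 f f'),
    hcomp (vcomp b' b) (vcomp a' a) = vcomp (hcomp b' a') (hcomp b a);
  assoc_nat : forall w x y z (h h' : cell1 y z) (g g' : cell1 x y)
    (f f' : cell1 w x) (c : cell2 h h') (b : cell2 g g') (a : cell2 f f'),
    vcomp (assoc h' g' f') (hcomp (hcomp c b) a) =
    vcomp (hcomp c (hcomp b a)) (assoc h g f);
  lunit_nat : forall x y (f f' : cell1 x y) (a : cell2 f f'),
    vcomp (lunit f') (hcomp (id2 (id1 y)) a) = vcomp a (lunit f);
  runit_nat : forall x y (f f' : cell1 x y) (a : cell2 f f'),
    vcomp (runit f') (hcomp a (id2 (id1 x))) = vcomp a (runit f);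
  assoc_inv : forall w x y z (h : cell1 y z) (g : cell1 x y) (f : cell1 w x),
    exists2 a, vcomp a (assoc h g f) = id2 _ & vcomp (assoc h g f) a = id2 _;
  lunit_inv : forall x y (f : cell1 x y),
    exists2 a, vcomp a (lunit f) = id2 _ & vcomp (lunit f) a = id2 _;
  runit_inv : forall x y (f : cell1 x y),
    exists2 a, vcomp a (runit f) = id2 _ & vcomp (runit f) a = id2 _;
  pentagon : forall v w x y z (k : cell1 y z) (h : cell1 x y) (g : cell1 w x)
    (f : cell1 v w),
    vcomp (assoc k h (comp1 g f)) (assoc (comp1 k h) g f) =
    vcomp (hcomp (id2 k) (assoc h g f))
          (vcomp (assoc k (comp1 h g) f) (hcomp (assoc k h g) (id2 f)));
  triangle : forall x y z (g : cell1 y z) (f : cell1 x y),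
    vcomp (hcomp (id2 g) (lunit f)) (assoc g (id1 y) f) =
    hcomp (runit g) (id2 f) }.

Arguments id2 {_ x y}.
Arguments vcomp {_ x y f g h}.
Arguments id1 {_}.
Arguments comp1 {_ x y z}.
Arguments hcomp {_ x y z g g' f f'}.
Arguments assoc {_ w x y z}.
Arguments lunit {_ x y}.
Arguments runit {_ x y}.

(* The action on objects is a parameter, so that prescribing it does not
   require transport along an equality of objects. *)
Record pseudofunctor (B C : bicategory) (F0 : B -> C) := Pseudofunctor {
  F1 : forall x y : B, cell1 x y -> cell1 (F0 x) (F0 y);
  F2 : forall (x y : B) (f g : cell1 x y),
    cell2 f g -> cell2 (F1 f) (F1 g);
  Fcomp : forall (x y z : B) (g : cell1 y z) (f : cell1 x y),
    cell2 (comp1 (F1 g) (F1 f)) (F1 (comp1 g f));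
  Fid : forall x : B, cell2 (id1 (F0 x)) (F1 (id1 x));
  F2_id2 : forall (x y : B) (f : cell1 x y), F2 (id2 f) = id2 (F1 f);
  F2_vcomp : forall (x y : B) (f g h : cell1 x y)
    (b : cell2 g h) (a : cell2 f g), F2 (vcomp b a) = vcomp (F2 b) (F2 a);
  Fcomp_inv : forall (x y z : B) (g : cell1 y z) (f : cell1 x y),
    exists2 a, vcomp a (Fcomp g f) = id2 _ & vcomp (Fcomp g f) a = id2 _;
  Fid_inv : forall x : B,
    exists2 a, vcomp a (Fid x) = id2 _ & vcomp (Fid x) a = id2 _;
  Fcomp_nat : forall (x y z : B) (g g' : cell1 y z) (f f' : cell1 x y)
    (b : cell2 g g') (a : cell2 f f'),
    vcomp (Fcomp g' f') (hcomp (F2 b) (F2 a)) =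
    vcomp (F2 (hcomp b a)) (Fcomp g f);
  Fassoc : forall (w x y z : B) (h : cell1 y z) (g : cell1 x y) (f : cell1 w x),
    vcomp (F2 (assoc h g f))
          (vcomp (Fcomp (comp1 h g) f) (hcomp (Fcomp h g) (id2 (F1 f)))) =
    vcomp (Fcomp h (comp1 g f))
          (vcomp (hcomp (id2 (F1 h)) (Fcomp g f)) (assoc (F1 h) (F1 g) (F1 f)));
  Flunit : forall (x y : B) (f : cell1 x y),
    vcomp (F2 (lunit f))
          (vcomp (Fcomp (id1 y) f) (hcomp (Fid y) (id2 (F1 f)))) =
    lunit (F1 f);
  Frunit : forall (x y : B) (f : cell1 x y),
    vcomp (F2 (runit f))
          (vcomp (Fcomp f (id1 x)) (hcomp (id2 (F1 f)) (Fid x))) =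
    runit (F1 f) }.

Record arrow (R : realType) (G : groupoid R) (x y : gob G) := Arrow {
  arr :> garr G;
  arr_src : gsrc arr = x;
  arr_tgt : gtgt arr = y }.

Section Delooping.
Context {R : realType} (G : lie_2group R).
Implicit Types x y z g : gob G.

Let lieG : is_lie_groupoid G := lgpdP G.

Lemma arrow_inj x y (b c : arrow x y) : arr b = arr c -> b = c.
Proof.
case: b c => [b sb tb] [c sc tc] /= bc; subst c.
by congr Arrow; exact: Prop_irrelevance.
Qed.

Definition arrow_id x : arrow x x :=
  Arrow (gsrc_id lieG x) (gtgt_id lieG x).

Definition arrow_comp x y z (c : arrow y z) (b : arrow x y) : arrow x z :=
  let e := etrans (arr_src c) (esym (arr_tgt b)) in
  Arrow (etrans (gsrc_comp lieG e) (arr_src b))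
        (etrans (gtgt_comp lieG e) (arr_tgt c)).

Definition arrow_inv x y (b : arrow x y) : arrow y x :=
  Arrow (etrans (gsrc_inv lieG b) (arr_tgt b))
        (etrans (gtgt_inv lieG b) (arr_src b)).

Fact arrow_mul_src (g g' f f' : gob G) (b : arrow g g') (a : arrow f f') :
  gsrc (arr b \.h arr a) = g \oh f.
Proof.
by rewrite /harr (gmap_src (l2_mul (l2P G))) /= (arr_src b) (arr_src a).
Qed.

Fact arrow_mul_tgt (g g' f f' : gob G) (b : arrow g g') (a : arrow f f') :
  gtgt (arr b \.h arr a) = g' \oh f'.
Proof.
by rewrite /harr (gmap_tgt (l2_mul (l2P G))) /= (arr_tgt b) (arr_tgt a).
Qed.

Definition arrow_mul (g g' f f' : gob G) (b : arrow g g') (a : arrow f f') :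
    arrow (g \oh f) (g' \oh f') :=
  Arrow (arrow_mul_src b a) (arrow_mul_tgt b a).

Definition arrow_assoc x y z :
    arrow ((x \oh y) \oh z) (x \oh (y \oh z)) :=
  Arrow (gnat_src (l2_assoc (l2P G)) (x, y, z))
        (gnat_tgt (l2_assoc (l2P G)) (x, y, z)).

Definition arrow_lunit x : arrow (munit \oh x) x :=
  Arrow (gnat_src (l2_lunit (l2P G)) x) (gnat_tgt (l2_lunit (l2P G)) x).

Definition arrow_runit x : arrow (x \oh munit) x :=
  Arrow (gnat_src (l2_runit (l2P G)) x) (gnat_tgt (l2_runit (l2P G)) x).

Fact arrow_isoP x y (b : arrow x y) :
  exists2 a, arrow_comp a b = arrow_id x & arrow_comp b a = arrow_id y.
Proof.
exists (arrow_inv b); apply: arrow_inj => /=.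
  by rewrite (gcompVl lieG) (arr_src b).
by rewrite (gcompVr lieG) (arr_tgt b).
Qed.

Definition delooping : bicategory.
Proof.
refine (@Bicategory unit (fun _ _ => gob G) (fun _ _ => @arrow R G)
  (fun _ _ => arrow_id) (fun _ _ => arrow_comp)
  (fun _ => munit) (fun _ _ _ g f => g \oh f)
  (fun _ _ _ => arrow_mul) (fun _ _ _ _ => arrow_assoc)
  (fun _ _ => arrow_lunit) (fun _ _ => arrow_runit)
  _ _ _ _ _ _ _ _ _ _ _ _ _).
- move=> _ _ f g h i c b a; apply: arrow_inj => /=; apply: (gcompA lieG).
    by rewrite (arr_src c) (arr_tgt b).
  by rewrite (arr_src b) (arr_tgt a).
- move=> _ _ f g a; apply: arrow_inj => /=.
  by rewrite -[X in gid X](arr_tgt a) (gcomp1l lieG).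
- move=> _ _ f g a; apply: arrow_inj => /=.
  by rewrite -[X in gid X](arr_src a) (gcomp1r lieG).
- move=> _ _ _ g f; apply: arrow_inj => /=.
  exact: (gmap_gid (l2_mul (l2P G)) (g, f)).
- move=> _ _ _ g g' g'' f f' f'' b' b a' a; apply: arrow_inj => /=.
  apply: (@gmap_gcomp _ _ _ _ (l2_mul (l2P G)) (arr b', arr a') (arr b, arr a)).
  by rewrite /= (arr_src b') (arr_src a') (arr_tgt b) (arr_tgt a).
- move=> _ _ _ _ h h' g g' f f' c b a; apply: arrow_inj => /=.
  have := gnat_naturality (l2_assoc (l2P G)) (arr c, arr b, arr a).
  by rewrite /= !arr_src !arr_tgt.
- move=> _ _ f f' a; apply: arrow_inj => /=.
  have := gnat_naturality (l2_lunit (l2P G)) (arr a).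
  by rewrite /= !arr_src !arr_tgt.
- move=> _ _ f f' a; apply: arrow_inj => /=.
  have := gnat_naturality (l2_runit (l2P G)) (arr a).
  by rewrite /= !arr_src !arr_tgt.
- by move=> *; exact: arrow_isoP.
- by move=> *; exact: arrow_isoP.
- by move=> *; exact: arrow_isoP.
- move=> _ _ _ _ _ k h g f; apply: arrow_inj => /=.
  exact: (l2_pentagon (l2P G)).
- move=> _ _ _ g f; apply: arrow_inj => /=.
  exact: (l2_triangle (l2P G)).
Defined.

End Delooping.

Record prelinear_cat (k : fieldType) := PrelinearCat {
  lob :> Type;
  lhom : lob -> lob -> lmodType k;
  lid : forall x, lhom x x;
  lcomp : forall x y z, lhom y z -> lhom x y -> lhom x z;
  lcompA : forall w x y z (h : lhom y z) (g : lhom x y) (f : lhom w x),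
    lcomp h (lcomp g f) = lcomp (lcomp h g) f;
  lcomp1l : forall x y (f : lhom x y), lcomp (lid y) f = f;
  lcomp1r : forall x y (f : lhom x y), lcomp f (lid x) = f;
  lcomp_linear_l : forall x y z (f : lhom x y),
    linear (fun g : lhom y z => lcomp g f);
  lcomp_linear_r : forall x y z (g : lhom y z),
    linear (fun f : lhom x y => lcomp g f) }.
Arguments lid {k p}.
Arguments lcomp {k p x y z}.

Section TwoVect.
Context (k : fieldType).
Implicit Types C D E : prelinear_cat k.

Record lfunctor C D := LFunctor {
  lf0 :> C -> D;
  lf1 : forall x y : C, lhom x y -> lhom (lf0 x) (lf0 y);
  lf1_linear : forall x y : C, linear (@lf1 x y);
  lf1_id : forall x : C, lf1 (lid x) = lid (lf0 x);
  lf1_comp : forall (x y z : C) (g : lhom y z) (f : lhom x y),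
    lf1 (lcomp g f) = lcomp (lf1 g) (lf1 f) }.

Record lnat C D (F G : lfunctor C D) := LNat {
  lnt :> forall x : C, lhom (F x) (G x);
  lnt_nat : forall (x y : C) (f : lhom x y),
    lcomp (lnt y) (lf1 F f) = lcomp (lf1 G f) (lnt x) }.

Lemma lnat_inj C D (F G : lfunctor C D) (a b : lnat F G) :
  (forall x, a x = b x) -> a = b.
Proof.
case: a b => [a aN] [b bN] /= ab.
have {}ab : a = b by apply: functional_extensionality_dep.
by subst b; congr LNat; exact: Prop_irrelevance.
Qed.

Definition lfunctor_id C : lfunctor C C.
Proof. by exists id (fun x y f => f). Defined.

Definition lfunctor_comp C D E (G : lfunctor D E) (F : lfunctor C D) :
  lfunctor C E.
Proof.
exists (fun x => G (F x)) (fun x y f => lf1 G (lf1 F f)).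
- by move=> x y a f g; rewrite !lf1_linear.
- by move=> x; rewrite !lf1_id.
- by move=> x y z g f; rewrite !lf1_comp.
Defined.

Definition lnat_id C D (F : lfunctor C D) : lnat F F.
Proof.
by exists (fun x => lid (F x)) => x y f; rewrite lcomp1l lcomp1r.
Defined.

Definition lnat_vcomp C D (F G H : lfunctor C D) (b : lnat G H) (a : lnat F G) :
  lnat F H.
Proof.
exists (fun x => lcomp (b x) (a x)) => x y f.
by rewrite -lcompA lnt_nat lcompA lnt_nat -lcompA.
Defined.

Definition lnat_hcomp C D E (G G' : lfunctor D E) (F F' : lfunctor C D)
    (b : lnat G G') (a : lnat F F') :
  lnat (lfunctor_comp G F) (lfunctor_comp G' F').
Proof.
exists (fun x => lcomp (b (F' x)) (lf1 G (a x))) => x y f /=.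
by rewrite -lcompA -lf1_comp (lnt_nat a) lf1_comp lcompA (lnt_nat b) -lcompA.
Defined.

(* 2Vect is strict, so the structure 2-cells have identity components. *)
Definition lnat_assoc C D E E' (H : lfunctor E E') (G : lfunctor D E)
    (F : lfunctor C D) :
  lnat (lfunctor_comp (lfunctor_comp H G) F)
       (lfunctor_comp H (lfunctor_comp G F)).
Proof.
refine (@LNat C E' (lfunctor_comp (lfunctor_comp H G) F)
  (lfunctor_comp H (lfunctor_comp G F)) (fun x => lid (H (G (F x)))) _).
by move=> x y f; rewrite lcomp1l lcomp1r.
Defined.

Definition lnat_lunit C D (F : lfunctor C D) :
  lnat (lfunctor_comp (lfunctor_id D) F) F.
Proof.
refine (@LNat C D (lfunctor_comp (lfunctor_id D) F) F (fun x => lid (F x)) _).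
by move=> x y f; rewrite lcomp1l lcomp1r.
Defined.

Definition lnat_runit C D (F : lfunctor C D) :
  lnat (lfunctor_comp F (lfunctor_id C)) F.
Proof.
refine (@LNat C D (lfunctor_comp F (lfunctor_id C)) F (fun x => lid (F x)) _).
by move=> x y f; rewrite lcomp1l lcomp1r.
Defined.

Definition TwoVect : bicategory.
Proof.
refine (@Bicategory (prelinear_cat k) lfunctor lnat
  lnat_id lnat_vcomp lfunctor_id lfunctor_comp lnat_hcomp
  lnat_assoc lnat_lunit lnat_runit
  _ _ _ _ _ _ _ _ _ _ _ _ _).
- by move=> *; apply: lnat_inj => u /=; rewrite lcompA.
- by move=> *; apply: lnat_inj => u /=; rewrite lcomp1l.
- by move=> *; apply: lnat_inj => u /=; rewrite lcomp1r.
- by move=> *; apply: lnat_inj => u /=; rewrite lf1_id lcomp1l.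
- move=> x y z g g' g'' f f' f'' b' b a' a; apply: lnat_inj => u /=.
  by rewrite lf1_comp -!lcompA; congr lcomp; rewrite !lcompA lnt_nat.
- move=> w x y z h h' g g' f f' c b a; apply: lnat_inj => u /=.
  by rewrite lcomp1l lcomp1r lf1_comp lcompA.
- by move=> *; apply: lnat_inj => u /=; rewrite !(lcomp1l, lcomp1r).
- by move=> *; apply: lnat_inj => u /=; rewrite lf1_id !(lcomp1l, lcomp1r).
- move=> w x y z h g f; unshelve eexists.
  + refine (@LNat _ _ (lfunctor_comp h (lfunctor_comp g f))
      (lfunctor_comp (lfunctor_comp h g) f) (fun u => lid (h (g (f u)))) _).
    by move=> u v e; rewrite lcomp1l lcomp1r.
  + by apply: lnat_inj => u /=; rewrite lcomp1l.
  + by apply: lnat_inj => u /=; rewrite lcomp1l.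
- move=> x y f; unshelve eexists.
  + refine (@LNat _ _ f (lfunctor_comp (lfunctor_id y) f)
      (fun u => lid (f u)) _).
    by move=> u v e; rewrite lcomp1l lcomp1r.
  + by apply: lnat_inj => u /=; rewrite lcomp1l.
  + by apply: lnat_inj => u /=; rewrite lcomp1l.
- move=> x y f; unshelve eexists.
  + refine (@LNat _ _ f (lfunctor_comp f (lfunctor_id x))
      (fun u => lid (f u)) _).
    by move=> u v e; rewrite lcomp1l lcomp1r.
  + by apply: lnat_inj => u /=; rewrite lcomp1l.
  + by apply: lnat_inj => u /=; rewrite lcomp1l.
- by move=> *; apply: lnat_inj => u /=; rewrite !lf1_id !lcomp1l.
- by move=> *; apply: lnat_inj => u /=; rewrite !lf1_id !lcomp1l.
Defined.

End TwoVect.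

(* A 2-representation of G on the prelinear category C: a pseudofunctor from
   the delooping of G to 2Vect sending the only object to C. *)
Definition two_rep (R : realType) (k : fieldType) (G : lie_2group R)
    (C : prelinear_cat k) : Type :=
  @pseudofunctor (delooping G) (TwoVect k) (fun _ => C).

Section TwoRep.
Context {R : realType} {k : fieldType} {G : lie_2group R} {C : prelinear_cat k}.
Variable P : two_rep G C.

Definition two_rep1 (g : gob G) : lfunctor C C := @F1 _ _ _ P tt tt g.

Definition two_rep2 (g0 g0' : gob G) (g1 : arrow g0 g0') :
    lnat (two_rep1 g0) (two_rep1 g0') :=
  @F2 _ _ _ P tt tt g0 g0' g1.

Definition two_rep_comp (g h : gob G) :
    lnat (lfunctor_comp (two_rep1 g) (two_rep1 h)) (two_rep1 (g \oh h)) :=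
  @Fcomp _ _ _ P tt tt tt g h.

Definition two_rep_unit : lnat (lfunctor_id C) (two_rep1 munit) :=
  @Fid _ _ _ P tt.

End TwoRep.

Section CkTheory.
Context {R : realType} {n : nat}.
Implicit Types (U : set 'rV[R]_n) (f g : 'rV[R]_n -> R).


Lemma near_eq_diff (V W : normedModType R) (f g : V -> W) (x : V) :
  (\forall y \near x, f y = g y) -> differentiable f x ->
  differentiable g x /\ 'd g x = 'd f x :> (V -> W).
Proof.
move=> fg df.
have fgx : f x = g x by exact: nbhs_singleton fg.
have gE : g \o shift x = cst (g x) + 'd f x +o_ 0 id.
  apply/eqaddoP => e e0.
  have /eqaddoP/(_ e e0) fo := diff_locally df.
  have fg0 : \forall h \near 0, f (h + x) = g (h + x).
    have : (fun h => h + x) @ 0 --> x.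
      by rewrite -[X in _ --> X]add0r; apply: cvgD; [exact: cvg_id|exact: cvg_cst].
    by move=> /(_ _ fg).
  near=> h.
  have -> : (g \o shift x - (cst (g x) + 'd f x)) h =
            (f \o shift x - (cst (f x) + 'd f x)) h.
    rewrite /= !fctE /= -fgx; congr (_ - _).
    by apply/esym; near: h.
  by near: h.
have gd := diff_unique (diff_continuous df) gE.
split=> //; apply/diff_locallyP; rewrite gd; split=> //.
exact: diff_continuous.
Unshelve. all: by end_near. Qed.

Lemma near_eq_continuous (V W : normedModType R) (f g : V -> W) (x : V) :
  (\forall y \near x, f y = g y) -> {for x, continuous f} ->
  {for x, continuous g}.
Proof.
move=> fg fx; rewrite /prop_for /continuous_at -(nbhs_singleton fg).
by apply: cvg_trans fx; exact: near_eq_cvg.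
Qed.

Lemma Ck_ext (W : normedModType R) j U (f g : 'rV[R]_n -> W) : open U ->
  (forall x, U x -> f x = g x) -> Ck j U f -> Ck j U g.
Proof.
move=> oU.
elim: j f g => [|j IH] f g fg.
  move=> fc x Ux; apply: near_eq_continuous (fc x Ux).
  exact: filterS fg (open_nbhs_nbhs (conj oU Ux)).
move=> [fd df].
have H x : U x -> differentiable g x /\ 'd g x = 'd f x :> ('rV[R]_n -> W).
  move=> Ux; apply: near_eq_diff (fd x Ux).
  exact: filterS fg (open_nbhs_nbhs (conj oU Ux)).
split=> [x /H[]//|v].
by apply: IH (df v) => x /H[_ ->].
Qed.

Lemma Ck_le (W : normedModType R) j U (f : 'rV[R]_n -> W) :
  Ck j.+1 U f -> Ck j U f.
Proof.
elim: j f => [|j IH] f /= [fd df].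
  by move=> x Ux; exact/differentiable_continuous/fd.
by split=> // v; exact/IH/df.
Qed.

Lemma Ck_cst (W : normedModType R) j U (w : W) : Ck j U (fun _ : 'rV[R]_n => w).
Proof.
elim: j w => [|j IH] w /=; first by move=> x _; exact: cst_continuous.
split=> [x _|v]; first exact: differentiable_cst.
rewrite (_ : (fun x => _) = fun=> 0) //.
by apply/funext => x; rewrite (diff_cst w x).
Qed.

Lemma CkD (W : normedModType R) j U (f g : 'rV[R]_n -> W) : open U ->
  Ck j U f -> Ck j U g -> Ck j U (f \+ g).
Proof.
move=> oU; elim: j f g => [|j IH] f g /=.
  by move=> fc gc x Ux; apply: continuousD; [exact: fc|exact: gc].
move=> [fd df] [gd dg]; split=> [x Ux|v].
  by apply: differentiableD; [exact: fd|exact: gd].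
apply: Ck_ext (IH _ _ (df v) (dg v)) => // x Ux /=.
by rewrite diffD; [|exact: fd|exact: gd].
Qed.

Lemma CkM j U f g : open U -> Ck j U f -> Ck j U g -> Ck j U (f \* g).
Proof.
move=> oU; elim: j f g => [|j IH] f g.
  by move=> fc gc x Ux; apply: continuousM; [exact: fc|exact: gc].
move=> fC gC; have [fd df] := fC; have [gd dg] := gC; split=> [x Ux|v].
  by apply: differentiableM; [exact: fd|exact: gd].
apply: Ck_ext (CkD oU (IH _ _ (Ck_le fC) (dg v)) (IH _ _ (Ck_le gC) (df v))) => //.
by move=> x Ux /=; rewrite diffM; [|exact: fd|exact: gd].
Qed.

End CkTheory.

Section SmoothVectorValued.
Context {R : realType} {k : fieldExtType R}.
Implicit Types (M : smooth_space R) (V W : vectType k).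

(* A finite field extension k of R is R or C, up to isomorphism.  W is then a
   finite-dimensional real vector space, and smoothness is tested on the
   R-valued functionals mu \o lambda, which span its real dual. *)
Definition smooth_vec M W (f : M -> W) : Prop :=
  forall (mu : 'Hom(k, R^o)) (lambda : 'Hom(W, k^o)),
    smooth_fun (fun x => mu (lambda (f x))).

Lemma smooth_fun_cst M (a : R) : smooth_fun (fun _ : M => a).
Proof. by move=> c _ j; exact: Ck_cst. Qed.

Section OnManifold.
Context M (manM : is_manifold M).

Let cimgO (c : chart R M (sdim M)) : satlas c -> open (cimg c).
Proof. by move=> /(manifold_chart manM)/cimg_open. Qed.

Lemma smooth_funD (f g : M -> R) :
  smooth_fun f -> smooth_fun g -> smooth_fun (fun x => f x + g x).
Proof.
move=> fs gs c cM j.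
exact: (CkD (cimgO cM) (fs c cM j) (gs c cM j)).
Qed.

Lemma smooth_funM (f g : M -> R) :
  smooth_fun f -> smooth_fun g -> smooth_fun (fun x => f x * g x).
Proof.
move=> fs gs c cM j.
exact: (CkM (cimgO cM) (fs c cM j) (gs c cM j)).
Qed.

Lemma smooth_fun_sum (I : Type) (r : seq I) (f : I -> M -> R) :
  (forall i, smooth_fun (f i)) -> smooth_fun (fun x => \sum_(i <- r) f i x).
Proof.
move=> fs; elim: r => [|i r IH].
  rewrite (_ : (fun x => _) = fun=> 0); first exact: smooth_fun_cst.
  by apply/funext => x; rewrite big_nil.
rewrite (_ : (fun x => _) = fun x => f i x + \sum_(i <- r) f i x).
  exact: smooth_funD.
by apply/funext => x; rewrite big_cons.
Qed.

Lemma smooth_scalarM (f g : M -> k) :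
  (forall mu : 'Hom(k, R^o), smooth_fun (fun x => mu (f x))) ->
  (forall mu : 'Hom(k, R^o), smooth_fun (fun x => mu (g x))) ->
  forall mu : 'Hom(k, R^o), smooth_fun (fun x => mu (f x * g x)).
Proof.
move=> fs gs mu; pose e := vbasis {:k}.
pose co i : 'Hom(k, R^o) := linfun (coord e i : k -> R^o).
have kE (a : k) : a = \sum_i co i a *: e`_i.
  rewrite {1}(coord_vbasis (memvf a)); apply: eq_bigr => i _.
  by rewrite lfunE.
rewrite (_ : (fun x => _) =
    fun x => \sum_i \sum_j (co i (f x) * co j (g x)) * mu (e`_i * e`_j)).
  apply: smooth_fun_sum => i; apply: smooth_fun_sum => j.
  apply: smooth_funM; last exact: smooth_fun_cst.
  by apply: smooth_funM; [exact: fs|exact: gs].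
apply/funext => x; rewrite {1}(kE (f x)) {1}(kE (g x)).
rewrite mulr_suml linear_sum; apply: eq_bigr => i _.
rewrite mulr_sumr linear_sum; apply: eq_bigr => j _.
by rewrite -scalerAl -scalerAr scalerA linearZ.
Qed.

Lemma smooth_vec_cst W (w : W) : smooth_vec (fun _ : M => w).
Proof. by move=> mu lambda; exact: smooth_fun_cst. Qed.

Lemma smooth_vec_linear W (a : k) (f g : M -> W) :
  smooth_vec f -> smooth_vec g -> smooth_vec (fun x => a *: f x + g x).
Proof.
move=> fs gs mu lambda.
rewrite (_ : (fun x => _) =
    fun x => mu ((a *: lambda) (f x)) + mu (lambda (g x))).
  by apply: smooth_funD; [exact: fs|exact: gs].
by apply/funext => x; rewrite linearP raddfD scale_lfunE.
Qed.

Lemma smooth_vec_comp (U V W : vectType k) (g : M -> 'Hom(V, W)) (f : M -> 'Hom(U, V)) :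
  smooth_vec g -> smooth_vec f -> smooth_vec (fun x => (g x \o f x)%VF).
Proof.
move=> gs fs mu lambda.
pose eg := vbasis (fullv : {vspace 'Hom(V, W)}).
pose ef := vbasis (fullv : {vspace 'Hom(U, V)}).
pose cg i : 'Hom('Hom(V, W), k^o) := linfun (coord eg i : _ -> k^o).
pose cf i : 'Hom('Hom(U, V), k^o) := linfun (coord ef i : _ -> k^o).
have gE h : h = \sum_i cg i h *: eg`_i.
  by rewrite {1}(coord_vbasis (memvf h)); apply: eq_bigr => i _; rewrite lfunE.
have fE h : h = \sum_i cf i h *: ef`_i.
  by rewrite {1}(coord_vbasis (memvf h)); apply: eq_bigr => i _; rewrite lfunE.
rewrite (_ : (fun x => _) = fun x => \sum_i \sum_j
    mu (cg i (g x) * cf j (f x) * lambda (eg`_i \o ef`_j)%VF)).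
  apply: smooth_fun_sum => i; apply: smooth_fun_sum => j.
  apply: smooth_scalarM => [|nu]; last exact: smooth_fun_cst.
  by apply: smooth_scalarM => nu; [exact: gs|exact: fs].
apply/funext => x; rewrite {1}(gE (g x)) {1}(fE (f x)).
rewrite (big_morph (fun h => h \o _)%VF (fun a b => comp_lfunDl a b _)
  (comp_lfun0l _ _)) !linear_sum; apply: eq_bigr => i _.
rewrite (big_morph (fun h => _ \o h)%VF (fun a b => comp_lfunDr _ a b)
  (comp_lfun0r _ _)) !linear_sum; apply: eq_bigr => j _.
by rewrite -comp_lfunZl -comp_lfunZr scalerA linearZ.
Qed.

End OnManifold.
End SmoothVectorValued.

(* The underlying data of a representation on the trivial bundle V x G_0. *)
Record rep_data (R : realType) (k : fieldExtType R) (G : groupoid R) := RepData {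
  rspace : vectType k;
  ract : garr G -> 'End(rspace) }.

Section TrivialRep.
Context {R : realType} (k : fieldExtType R) (G : lie_groupoid R).

(* The groupoid of linear isomorphisms between the fibres of V x G_0 is
   G_0 x GL(V) x G_0; a morphism of Lie groupoids over the identity of G_0 from
   G to it amounts to a smooth functorial map from the arrows to End(V). *)
Record is_rep (rho : rep_data k G) : Prop := {
  ract_smooth : smooth_vec (ract rho);
  ract_id : forall x, ract rho (gid x) = \1%VF;
  ract_comp : forall c b, gsrc c = gtgt b ->
    ract rho (gcomp c b) = (ract rho c \o ract rho b)%VF }.

Record trivial_rep := TrivialRep {
  trep_data :> rep_data k G;
  trepP : is_rep trep_data }.

Implicit Types rho : trivial_rep.

(* A bundle map V x G_0 -> V' x G_0 is a smooth map G_0 -> Hom(V, V'). *)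
Definition equivariant rho rho' :
    pred (gob G -> 'Hom(rspace rho, rspace rho')) :=
  fun f => `[< smooth_vec f /\ forall b : garr G,
    (f (gtgt b) \o ract rho b = ract rho' b \o f (gsrc b))%VF >].

Record rep_mor rho rho' := RepMor {
  rmap : gob G -> 'Hom(rspace rho, rspace rho');
  rmap_equivariant : rmap \in @equivariant rho rho' }.

HB.instance Definition _ rho rho' := [isSub for @rmap rho rho'].
HB.instance Definition _ rho rho' := [Choice of rep_mor rho rho' by <:].

Fact equivariant_submod_closed rho rho' : submod_closed (@equivariant rho rho').
Proof.
split=> [|a f g].
  rewrite inE; split; first exact: smooth_vec_cst.
  by move=> b; rewrite /= comp_lfun0l comp_lfun0r.
rewrite !inE => -[fs fe] [gs ge]; split.
  exact: (smooth_vec_linear (gob_manifold (lgpdP G))).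
move=> b; rewrite /= !fctE comp_lfunDl comp_lfunDr.
by rewrite -comp_lfunZl -comp_lfunZr fe ge.
Qed.

HB.instance Definition _ rho rho' :=
  GRing.isSubmodClosed.Build k _ (@equivariant rho rho')
    (@equivariant_submod_closed rho rho').
HB.instance Definition _ rho rho' :=
  [SubChoice_isSubLmodule of rep_mor rho rho' by <:].

Lemma rep_morP rho rho' (f : rep_mor rho rho') :
  smooth_vec (rmap f) /\ forall b : garr G,
    (rmap f (gtgt b) \o ract rho b = ract rho' b \o rmap f (gsrc b))%VF.
Proof. by have := rmap_equivariant f; rewrite inE. Qed.

Fact rep_id_subproof rho : (fun=> \1%VF) \in @equivariant rho rho.
Proof.
rewrite inE; split; first exact: smooth_vec_cst.
by move=> b; rewrite comp_lfun1l comp_lfun1r.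
Qed.

Definition rep_id rho : rep_mor rho rho := RepMor (rep_id_subproof rho).

Fact rep_comp_subproof rho rho' rho'' (g : rep_mor rho' rho'')
    (f : rep_mor rho rho') :
  (fun x => rmap g x \o rmap f x)%VF \in @equivariant rho rho''.
Proof.
have [gs ge] := rep_morP g; have [fs fe] := rep_morP f.
rewrite inE; split.
  exact: (smooth_vec_comp (gob_manifold (lgpdP G))).
by move=> b; rewrite -comp_lfunA fe comp_lfunA ge comp_lfunA.
Qed.

Definition rep_comp rho rho' rho'' (g : rep_mor rho' rho'')
    (f : rep_mor rho rho') : rep_mor rho rho'' :=
  RepMor (rep_comp_subproof g f).

Definition Rep_tr : prelinear_cat k.
Proof.
refine (@PrelinearCat k trivial_rep (fun rho rho' => rep_mor rho rho')
  rep_id rep_comp _ _ _ _ _).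
- by move=> *; apply/val_inj/funext => x /=; rewrite comp_lfunA.
- by move=> *; apply/val_inj/funext => x /=; rewrite comp_lfun1l.
- by move=> *; apply/val_inj/funext => x /=; rewrite comp_lfun1r.
- move=> rho rho' rho'' f a g h; apply/val_inj/funext => x /=.
  by rewrite !fctE comp_lfunDl -comp_lfunZl.
- move=> rho rho' rho'' f a g h; apply/val_inj/funext => x /=.
  by rewrite !fctE comp_lfunDr -comp_lfunZr.
Defined.

End TrivialRep.

(* A morphism packaged with its source and target bundles V x G_0 and
   V' x G_0, so that morphisms whose bundles are only propositionally equal to
   the expected ones can be compared. *)
Record bundle_map (R : realType) (k : fieldExtType R) (G : groupoid R) :=
  BundleMap {
    bdom : vectType k;
    bcod : vectType k;
    bmap : gob G -> 'Hom(bdom, bcod) }.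

Definition rep_bundle_map (R : realType) (k : fieldExtType R)
    (G : lie_groupoid R) (rho rho' : Rep_tr k G) (f : lhom rho rho') :
    bundle_map k G :=
  BundleMap (rmap (f : rep_mor rho rho')).

(* Main.v *)
Require Import Defs.
From HB Require Import structures.
From mathcomp Require Import all_boot all_order all_algebra all_field.
From mathcomp Require Import all_classical all_reals all_analysis.

Set Implicit Arguments.
Unset Strict Implicit.
Unset Printing Implicit Defensive.
Import Order.TTheory GRing.Theory Num.Theory numFieldNormedType.Exports.
Local Open Scope classical_set_scope.
Local Open Scope ring_scope.

(** The object [g] acts by right translation: [rho] is precomposed with the
    functor [_ \oh g] from [G] to itself.  Precomposition does not change the
    vector space of a trivial bundle, so that trivial representations are
    preserved.  An arrow [g0 -> g0'] is a natural transformation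
    [_ \oh g0 => _ \oh g0'], and [rho] turns it into a morphism of
    representations.  The associator and the right unitor likewise become the
    comparison isomorphisms of the pseudofunctor.  [F_g \o F_h] corresponds to
    [F_(g \oh h)], and not to [F_(h \oh g)], because precomposition reverses the
    order once and right translation reverses it again.

    Each axiom is then an equation between arrows of [G], transported along the
    functor [rho]: naturality and interchange give the functoriality statements,
    the pentagon gives the associativity axiom, and the triangle gives the left
    unit axiom.  The right unit axiom needs the equation
    [(1_x . r_y) o a_(x,y,I) = r_(x y)], which is not among the axioms of a
    2-group.  It is Kelly's consequence of the pentagon and the triangle, and is
    proved in an arbitrary bicategory ([hcomp_runit]).

    The remaining content is analytic: the shifted representations and all the
    components have to be smooth.  They are of the form [phi \o f], with [phi] a
    representation or a morphism of representations and [f] a composite of the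
    structure maps of [G] and of pairings with constants.  What is needed is
    therefore a chain rule for functions that are smooth in the sense of iterated
    directional derivatives ([Ck_comp]), its consequence that smooth functions pull
    back along smooth maps ([smooth_fun_comp]), and smoothness of pairings into a
    product ([smooth_map_pair]). *)

(** * Calculus of functions of class C^j *)

Section CkCalculus.
Context {R : realType}.

Lemma linear_rV_continuous n (W : normedModType R) (L : {linear 'rV[R]_n -> W}) :
  continuous L.
Proof.
move=> x.
rewrite (_ : (L : 'rV[R]_n -> W) = fun y => \sum_i y 0 i *: L (delta_mx 0 i)).
  apply: continuous_big => [|i _]; first exact: add_continuous.
  move=> y.
  apply: (@continuous_comp _ _ _ (fun y : 'rV[R]_n => y 0 i) ( *:%R ^~ _)).
    exact: coord_continuous.
  exact: scalel_continuous.
apply/funext => y; rewrite {1}(row_sum_delta y) linear_sum.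
by apply: eq_bigr => i _; rewrite linearZ.
Qed.

Lemma row_mx_mulmxE m p (u : 'rV[R]_m) (v : 'rV[R]_p) :
  row_mx u v = u *m row_mx 1%:M 0 + v *m row_mx 0 1%:M.
Proof. by rewrite !mul_mx_row !mulmx1 !mulmx0 add_row_mx addr0 add0r. Qed.

Context {n : nat}.
Implicit Types U V : set 'rV[R]_n.

Lemma Ck_sub (W : normedModType R) j U V (f : 'rV[R]_n -> W) :
  V `<=` U -> Ck j U f -> Ck j V f.
Proof.
move=> VU; elim: j f => [|j IH] f /=; first by move=> fc x /VU; exact: fc.
by move=> [fd df]; split=> [x /VU|v]; [exact: fd | exact: IH].
Qed.

(** [Ck] speaks about the continuity and the differentials of [f] as a function on
    the ambient space, and not of its restriction to [U]; it is therefore a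
    condition on each point of [U] separately. *)
Lemma Ck_local (W : normedModType R) j U (f : 'rV[R]_n -> W) :
  (forall x, U x -> exists V, V x /\ Ck j V f) -> Ck j U f.
Proof.
elim: j f => [|j IH] f Uf /=; first by move=> x /Uf[V [Vx]]; exact.
split=> [x /Uf[V [Vx [fd _]]]|v]; first exact: fd.
by apply: IH => x /Uf[V [Vx [_ /(_ v) df]]]; exists V.
Qed.

Lemma Ck_linear m (W : normedModType R) (L : {linear 'rV[R]_m -> W}) j U
    (f : 'rV[R]_n -> 'rV[R]_m) :
  open U -> Ck j U f -> Ck j U (L \o f).
Proof.
have Lc := @linear_rV_continuous _ _ L; move=> oU.
elim: j f => [|j IH] f /=.
  by move=> fc x Ux; apply: continuous_comp; [exact: fc | exact: Lc].
have Ld y : differentiable L y by exact: linear_differentiable.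
move=> [fd df]; split=> [x Ux|v].
  by apply: differentiable_comp; [exact: fd | exact: Ld].
apply: Ck_ext (IH _ (df v)) => // x Ux.
by rewrite (diff_comp (fd x Ux) (Ld _)) (diff_lin _ Lc).
Qed.

Lemma Ck_sum j U (I : Type) (r : seq I) (f : I -> 'rV[R]_n -> R) : open U ->
  (forall i, Ck j U (f i)) -> Ck j U (fun x => \sum_(i <- r) f i x).
Proof.
move=> oU fC; elim: r => [|i r IH].
  rewrite (_ : (fun x => _) = fun=> 0); first exact: Ck_cst.
  by apply/funext => x; rewrite big_nil.
rewrite (_ : (fun x => _) = f i \+ fun x => \sum_(j <- r) f j x).
  exact: CkD.
by apply/funext => x; rewrite big_cons.
Qed.

(** The chain rule.  The directional derivative of [g \o f] is a sum of products
    of components of ['d f x v] with partial derivatives of [g] at [f x].  The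
    partial derivatives are taken along fixed basis vectors, so that each is again
    a C^j function composed with [f], to which the induction hypothesis applies. *)
Lemma Ck_comp m j U (V : set 'rV[R]_m) (f : 'rV[R]_n -> 'rV[R]_m)
    (g : 'rV[R]_m -> R) :
  open U -> (forall x, U x -> V (f x)) -> Ck j U f -> Ck j V g ->
  Ck j U (g \o f).
Proof.
move=> oU UV; elim: j g => [|j IH] g fC.
  by move=> gc x Ux; apply: continuous_comp; [exact: fC | exact/gc/UV].
have [fd df] := fC; move=> [gd dg]; split=> [x Ux|v].
  by apply: differentiable_comp; [exact: fd | exact/gd/UV].
pose h i x := ('d f x v) 0 i * 'd g (f x) (delta_mx 0 i).
have hC : Ck j U (fun x => \sum_i h i x).
  apply: Ck_sum => // i; apply: CkM => //.
    have coord_linear : linear (fun y : 'rV[R]_m => y 0 i).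
      by move=> a y z; rewrite !mxE.
    pose L : {linear 'rV[R]_m -> R} := HB.pack (fun y : 'rV[R]_m => y 0 i)
      (GRing.isLinear.Build _ _ _ _ _ coord_linear).
    exact: (@Ck_linear _ _ L _ _ _ oU (df v)).
  exact: (IH _ (Ck_le fC) (dg _)).
apply: Ck_ext hC => // x Ux.
rewrite (diff_comp (fd x Ux) (gd _ (UV x Ux))) /= [in RHS](row_sum_delta ('d f x v)).
by rewrite linear_sum; apply: eq_bigr => i _; rewrite linearZ.
Qed.

Lemma Ck_row_mx m p j U (f : 'rV[R]_n -> 'rV[R]_m) (g : 'rV[R]_n -> 'rV[R]_p) :
  open U -> Ck j U f -> Ck j U g -> Ck j U (fun x => row_mx (f x) (g x)).
Proof.
move=> oU fC gC.
rewrite (_ : (fun x => _) = (mulmxr (row_mx 1%:M 0) \o f) \+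
                           (mulmxr (row_mx 0 1%:M) \o g)).
  by apply: CkD => //; exact: Ck_linear.
by apply/funext => x; rewrite row_mx_mulmxE.
Qed.

End CkCalculus.

(** * Smooth maps of charted spaces *)

Section ChartedSpaces.
Context {R : realType}.
Implicit Types M N P : smooth_space R.

(** The part of the manifold axioms on which composing and pairing smooth maps
    rests.  It passes to products, and so holds for the domains of the
    multiplication and of the associator. *)
Record charted M : Prop := {
  charted_chart : forall c : chart R M (sdim M), satlas c -> is_chart c;
  charted_cover : forall x : M, exists2 c, satlas c & cdom c x }.

Lemma manifold_charted M : is_manifold M -> charted M.
Proof. by case. Qed.

Lemma open_chart_preimage M (T : topologicalType) (c : chart R M (sdim M))
    (f : M -> T) (D : set T) :
  is_chart c -> (forall x, {for x, continuous f}) -> open D ->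
  open [set y | cimg c y /\ D (f (cinv c y))].
Proof.
move=> cP fc oD; rewrite openE => y [cy Dy]; rewrite /interior.
apply: filterI; first exact: open_nbhs_nbhs (conj (cimg_open cP) cy).
have fcc : {for y, continuous (f \o cinv c)}.
  by apply: continuous_comp; [exact: cinv_continuous cP _ cy | exact: fc].
by apply: fcc; exact: open_nbhs_nbhs.
Qed.

Lemma continuous_pair (T A B : topologicalType) (f : T -> A) (g : T -> B) (x : T) :
  {for x, continuous f} -> {for x, continuous g} ->
  {for x, continuous (fun y => (f y, g y))}.
Proof. by move=> fc gc; exact: (cvg_pair fc gc). Qed.

Lemma continuous_row_mx (T : topologicalType) m n (f : T -> 'rV[R]_m)
    (g : T -> 'rV[R]_n) (x : T) :
  {for x, continuous f} -> {for x, continuous g} ->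
  {for x, continuous (fun y => row_mx (f y) (g y))}.
Proof.
move=> fc gc.
rewrite (_ : (fun y => _) = (mulmxr (row_mx 1%:M 0) \o f) \+
                           (mulmxr (row_mx 0 1%:M) \o g)).
  by apply: continuousD; (apply: continuous_comp; [|exact: linear_rV_continuous]).
by apply/funext => y; rewrite row_mx_mulmxE.
Qed.

Lemma prod_is_chart (M N : topologicalType) m n
    (c : chart R M m) (d : chart R N n) :
  is_chart c -> is_chart d -> is_chart (prod_chart c d).
Proof.
move=> cP dP; split=> /=.
- rewrite (_ : [set p | _] = (fst @^-1` cdom c) `&` (snd @^-1` cdom d)) //.
  apply: openI; apply: open_comp; [|exact: cdom_open cP| |exact: cdom_open dP].
    by move=> p _; exact: cvg_fst.
  by move=> p _; exact: cvg_snd.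
- rewrite (_ : [set p | _] = (lsubmx @^-1` cimg c) `&` (rsubmx @^-1` cimg d)) //.
  apply: openI; apply: open_comp; [|exact: cimg_open cP| |exact: cimg_open dP].
    by move=> p _; exact: continuous_lsubmx.
  by move=> p _; exact: continuous_rsubmx.
- by move=> p [cp dp]; rewrite row_mxKl row_mxKr; split; exact: cmap_img.
- by move=> y [cy dy]; split; exact: cinv_dom.
- by move=> [p q] /= [cp dp]; rewrite row_mxKl row_mxKr !cmapK.
- by move=> y [cy dy]; rewrite !cinvK ?hsubmxK.
- move=> p [cp dp]; apply: continuous_row_mx.
    by apply: continuous_comp; [exact: cvg_fst | exact: cmap_continuous cP _ cp].
  by apply: continuous_comp; [exact: cvg_snd | exact: cmap_continuous dP _ dp].
- move=> y [cy dy].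
  apply: (continuous_pair (f := cinv c \o lsubmx) (g := cinv d \o rsubmx)).
    apply: continuous_comp; first exact: continuous_lsubmx.
    exact: cinv_continuous cP _ cy.
  apply: continuous_comp; first exact: continuous_rsubmx.
  exact: cinv_continuous dP _ dy.
Qed.

Lemma charted_prod M N : charted M -> charted N -> charted (sprod M N).
Proof.
move=> chM chN; split=> [e [c [d [cM dN ->]]]|[x y]].
  by apply: prod_is_chart; [exact: charted_chart cM | exact: charted_chart dN].
have [c cM cx] := charted_cover chM x; have [d dN dy] := charted_cover chN y.
by exists (prod_chart c d) => //; exists c, d.
Qed.

Lemma smooth_map_id M : is_manifold M -> smooth_map (id : M -> M).
Proof.
move=> manM; split=> [x _|c d cM dM j]; first exact: cvg_id.
by apply: Ck_sub (manifold_compat manM cM dM j) => y [cy _ dy].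
Qed.

Lemma smooth_map_cst M N (q : N) : smooth_map (fun _ : M => q).
Proof. by split=> [x _|c d cM dN j]; [exact: cst_continuous | exact: Ck_cst]. Qed.

Lemma smooth_map_pair P M N (f : P -> M) (g : P -> N) :
  charted P -> charted M -> charted N -> smooth_map f -> smooth_map g ->
  smooth_map (fun x => (f x, g x) : sprod M N).
Proof.
move=> chP chM chN [fc fs] [gc gs]; split=> [x _|e h eP [c [d [cM dN ->]]] j].
  by apply: continuous_pair; [exact: fc | exact: gc].
have eC := charted_chart chP eP.
have oU : open [set y | [/\ cimg e y, setT (cinv e y) &
    cdom (prod_chart c d) (f (cinv e y), g (cinv e y))]].
  rewrite (_ : [set y | _] = [set y | cimg e y /\ cdom c (f (cinv e y))] `&`
                             [set y | cimg e y /\ cdom d (g (cinv e y))]).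
    apply: openI; apply: open_chart_preimage => //.
    - by move=> x; exact: fc.
    - exact: cdom_open (charted_chart chM cM).
    - by move=> x; exact: gc.
    - exact: cdom_open (charted_chart chN dN).
  by apply/seteqP; split=> y /=; [case=> ? _ [] | case=> -[? ?] [_ ?]].
apply: (Ck_row_mx (f := cmap c \o f \o cinv e) (g := cmap d \o g \o cinv e)) => //.
  by apply: Ck_sub (fs e c eP cM j) => y [? _ []].
by apply: Ck_sub (gs e d eP dN j) => y [? _ []].
Qed.

(** Smoothness of [h \o f] in a chart [c] is local there.  Near a point, [f]
    takes its values in one chart [d], and the function factors as
    [(h \o cinv d) \o (cmap d \o f \o cinv c)]. *)
Lemma smooth_fun_comp M N (f : M -> N) (h : N -> R) :
  charted M -> charted N -> smooth_map f -> smooth_fun h ->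
  smooth_fun (fun x => h (f x)).
Proof.
move=> chM chN [fc fs] hs c cM j; apply: Ck_local => y cy.
have [d dN dfy] := charted_cover chN (f (cinv c y)).
have dC := charted_chart chN dN.
set U := [set y | cimg c y /\ cdom d (f (cinv c y))].
have oU : open U.
  apply: open_chart_preimage => [|x|]; first exact: charted_chart cM.
    exact: fc.
  exact: cdom_open dC.
exists U; split; first by split.
have hfC : Ck j U ((h \o cinv d) \o (cmap d \o f \o cinv c)).
  apply: (Ck_comp (V := cimg d)) => // [z [_ dz]||].
  - exact: cmap_img dC _ dz.
  - by apply: Ck_sub (fs c d cM dN j) => z [cz dz].
  - exact: hs.
by apply: Ck_ext hfC => // z [_ dz] /=; rewrite (cmapK dC dz).
Qed.

Lemma smooth_vec_pullback (k : fieldExtType R) (W : vectType k) M N (f : M -> N)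
    (h : N -> W) :
  charted M -> charted N -> smooth_map f -> smooth_vec h ->
  smooth_vec (fun x => h (f x)).
Proof.
move=> chM chN fs hs mu lambda.
exact: (smooth_fun_comp chM chN fs (hs mu lambda)).
Qed.

End ChartedSpaces.

(** * Coherence in a bicategory *)

Section BicategoryCoherence.
Variable B : bicategory.

Lemma vcomp_injl (x y : B) (f g h : cell1 x y) (c : cell2 g h) :
  (exists2 d, vcomp d c = id2 _ & vcomp c d = id2 _) ->
  injective (fun a : cell2 f g => vcomp c a).
Proof.
by move=> [d dc _] a b /(congr1 (vcomp d)); rewrite !vcompA dc !vcomp1l.
Qed.

Lemma vcomp_injr (x y : B) (f g h : cell1 x y) (c : cell2 f g) :
  (exists2 d, vcomp d c = id2 _ & vcomp c d = id2 _) ->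
  injective (fun a : cell2 g h => vcomp a c).
Proof.
move=> [d _ cd] a b /(congr1 (fun e => vcomp e d)).
by rewrite -!vcompA cd !vcomp1r.
Qed.

(** The right unitor is a natural isomorphism from whiskering with the unit
    1-cell to the identity. *)
Lemma hcomp_runit_inj (x y : B) (f g : cell1 x y) :
  injective (fun a : cell2 f g => hcomp a (id2 (id1 x))).
Proof.
move=> a b /(congr1 (vcomp (runit g))); rewrite !runit_nat.
exact/vcomp_injr/runit_inv.
Qed.

Lemma hcomp_vcompl (x y z : B) (g g' g'' : cell1 y z) (f : cell1 x y)
    (b : cell2 g' g'') (a : cell2 g g') :
  hcomp (vcomp b a) (id2 f) = vcomp (hcomp b (id2 f)) (hcomp a (id2 f)).
Proof. by rewrite -Defs.interchange vcomp1l. Qed.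

Lemma hcomp_vcompr (x y z : B) (g : cell1 y z) (f f' f'' : cell1 x y)
    (b : cell2 f' f'') (a : cell2 f f') :
  hcomp (id2 g) (vcomp b a) = vcomp (hcomp (id2 g) b) (hcomp (id2 g) a).
Proof. by rewrite -Defs.interchange vcomp1l. Qed.

Lemma hcomp_splitl (x y z : B) (g g' : cell1 y z) (f f' : cell1 x y)
    (b : cell2 g g') (a : cell2 f f') :
  vcomp (hcomp b (id2 f')) (hcomp (id2 g) a) = hcomp b a.
Proof. by rewrite -Defs.interchange vcomp1l vcomp1r. Qed.

Lemma hcomp_splitr (x y z : B) (g g' : cell1 y z) (f f' : cell1 x y)
    (b : cell2 g g') (a : cell2 f f') :
  vcomp (hcomp (id2 g') a) (hcomp b (id2 f)) = hcomp b a.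
Proof. by rewrite -Defs.interchange vcomp1l vcomp1r. Qed.

(** Kelly's argument.  Whiskering with the unit 1-cell is faithful and the
    associator is invertible, so that it is enough to compare the whiskered
    2-cells after composition with [assoc g f id1].  Both sides are then rewritten
    by naturality of the associator and the triangle into the pentagon for [g],
    [f], [id1] and [id1]. *)
Lemma hcomp_runit (x y z : B) (g : cell1 y z) (f : cell1 x y) :
  vcomp (hcomp (id2 g) (runit f)) (assoc g f (id1 x)) = runit (comp1 g f).
Proof.
apply: hcomp_runit_inj => /=; apply: (vcomp_injl (assoc_inv g f (id1 x))) => /=.
rewrite hcomp_vcompl vcompA assoc_nat -vcompA -triangle hcomp_vcompr -!vcompA.
rewrite -pentagon -[in RHS]triangle [RHS]vcompA -[in RHS]hcomp_id2 assoc_nat.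
by rewrite -vcompA.
Qed.

End BicategoryCoherence.

(** * Invertible natural transformations *)

(** The inverse may be given componentwise, as naturality of the inverse
    components is automatic. *)
Lemma lnat_invertible (k : fieldType) (C D : prelinear_cat k) (F G : lfunctor C D)
    (a : lnat F G) (b : forall x : C, lhom (G x) (F x)) :
  (forall x, lcomp (b x) (a x) = lid (F x)) ->
  (forall x, lcomp (a x) (b x) = lid (G x)) ->
  exists2 b' : lnat G F,
    lnat_vcomp b' a = lnat_id F & lnat_vcomp a b' = lnat_id G.
Proof.
move=> ba ab.
have bN (x y : C) (f : lhom x y) : lcomp (b y) (lf1 G f) = lcomp (lf1 F f) (b x).
  rewrite -[in LHS](lcomp1r (lf1 G f)) -ab (lcompA (lf1 G f)) -lnt_nat.
  by rewrite !lcompA ba lcomp1l.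
by exists (LNat bN); apply: lnat_inj.
Qed.

(** * Translation of representations *)

Section Translation.
Context {R : realType} {k : fieldExtType R} {G : lie_2group R}.
Implicit Types (rho : trivial_rep k G) (x y z g h : gob G).

Let lieG : is_lie_groupoid G := lgpdP G.

Definition arrow_of (b : garr G) : arrow (gsrc b) (gtgt b) :=
  Arrow erefl erefl.

(** The laws of the delooping are restated for arrows, so that [ract rho] can be
    applied to both sides; it then turns each of them into an equation between
    linear maps. *)
Lemma arrow_mul_splitl x x' y y' (b : arrow x x') (a : arrow y y') :
  arrow_comp (arrow_mul b (arrow_id y')) (arrow_mul (arrow_id x) a) =
  arrow_mul b a.
Proof. exact: (@hcomp_splitl (delooping G) tt tt tt). Qed.

Lemma arrow_mul_splitr x x' y y' (b : arrow x x') (a : arrow y y') :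
  arrow_comp (arrow_mul (arrow_id x') a) (arrow_mul b (arrow_id y)) =
  arrow_mul b a.
Proof. exact: (@hcomp_splitr (delooping G) tt tt tt). Qed.

Lemma arrow_mul_id x y : arrow_mul (arrow_id x) (arrow_id y) = arrow_id (x \oh y).
Proof. exact: (@hcomp_id2 (delooping G) tt tt tt). Qed.

Lemma arrow_mul_compr x y y' y'' (b : arrow y' y'') (a : arrow y y') :
  arrow_mul (arrow_id x) (arrow_comp b a) =
  arrow_comp (arrow_mul (arrow_id x) b) (arrow_mul (arrow_id x) a).
Proof. exact: (@hcomp_vcompr (delooping G) tt tt tt). Qed.

Lemma arrow_assoc_nat x x' y y' z z' (c : arrow x x') (b : arrow y y')
    (a : arrow z z') :
  arrow_comp (arrow_assoc x' y' z') (arrow_mul (arrow_mul c b) a) =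
  arrow_comp (arrow_mul c (arrow_mul b a)) (arrow_assoc x y z).
Proof. exact: (@assoc_nat (delooping G) tt tt tt tt). Qed.

Lemma arrow_runit_nat x x' (b : arrow x x') :
  arrow_comp (arrow_runit x') (arrow_mul b (arrow_id munit)) =
  arrow_comp b (arrow_runit x).
Proof. exact: (@runit_nat (delooping G) tt tt). Qed.

Lemma arrow_pentagon w x y z :
  arrow_comp (arrow_assoc w x (y \oh z)) (arrow_assoc (w \oh x) y z) =
  arrow_comp (arrow_mul (arrow_id w) (arrow_assoc x y z))
    (arrow_comp (arrow_assoc w (x \oh y) z)
      (arrow_mul (arrow_assoc w x y) (arrow_id z))).
Proof. exact: (@pentagon (delooping G) tt tt tt tt tt). Qed.

Lemma arrow_triangle x y :
  arrow_comp (arrow_mul (arrow_id x) (arrow_lunit y)) (arrow_assoc x munit y) =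
  arrow_mul (arrow_runit x) (arrow_id y).
Proof. exact: (@triangle (delooping G) tt tt tt). Qed.

Lemma arrow_mul_runit x y :
  arrow_comp (arrow_mul (arrow_id x) (arrow_runit y)) (arrow_assoc x y munit) =
  arrow_runit (x \oh y).
Proof. exact: (@hcomp_runit (delooping G) tt tt tt). Qed.

Lemma ract_arrow_comp rho x y z (c : arrow y z) (b : arrow x y) :
  ract rho (arrow_comp c b) = (ract rho c \o ract rho b)%VF.
Proof. by rewrite (ract_comp (trepP rho)) // arr_src arr_tgt. Qed.

Lemma ract_arrow_id rho x : ract rho (arrow_id x) = \1%VF.
Proof. exact: ract_id (trepP rho) x. Qed.

Lemma ract_ginvK rho (b : garr G) : (ract rho (ginv b) \o ract rho b = \1)%VF.
Proof.
rewrite -(ract_comp (trepP rho)) ?(gsrc_inv lieG) //.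
by rewrite (gcompVl lieG) (ract_id (trepP rho)).
Qed.

Lemma ract_ginvVK rho (b : garr G) : (ract rho b \o ract rho (ginv b) = \1)%VF.
Proof.
rewrite -(ract_comp (trepP rho)) ?(gtgt_inv lieG) //.
by rewrite (gcompVr lieG) (ract_id (trepP rho)).
Qed.

(** On ['End(V)] the operation [^-1] yields a two-sided inverse only for
    bijective maps; arrows act bijectively because they are invertible. *)
Lemma ract_inv rho (b : garr G) : ((ract rho b)^-1)%VF = ract rho (ginv b).
Proof.
have ker0 : lker (ract rho b) == 0%VS.
  apply/lker0P/(can_inj (g := ract rho (ginv b))) => v.
  by rewrite -comp_lfunE ract_ginvK id_lfunE.
rewrite -[LHS]comp_lfun1r -(ract_ginvVK rho b) comp_lfunA.
by rewrite (lker0_compVf ker0) comp_lfun1l.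
Qed.

Lemma ract_inv_square rho rho' (b b' : garr G)
    (p q : 'Hom(rspace rho, rspace rho')) :
  (ract rho' b' \o p = q \o ract rho b)%VF ->
  ((ract rho' b')^-1 \o q = p \o (ract rho b)^-1)%VF.
Proof.
move=> sq; rewrite !ract_inv -[p]comp_lfun1l -(ract_ginvK rho' b').
rewrite -2!comp_lfunA [(_ \o (p \o _))%VF]comp_lfunA sq.
by rewrite -comp_lfunA ract_ginvVK comp_lfun1r.
Qed.

Let chA : charted (garr G) := manifold_charted (garr_manifold lieG).
Let chO : charted (gob G) := manifold_charted (gob_manifold lieG).

Lemma smooth_ract_mul (M : smooth_space R) rho (f1 f2 : M -> garr G) :
  charted M -> smooth_map f1 -> smooth_map f2 ->
  smooth_vec (fun p : M => ract rho (f1 p \.h f2 p)).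
Proof.
move=> chM f1s f2s.
apply: (smooth_vec_pullback (N := sprod (garr G) (garr G))
  (f := fun p => (f1 p, f2 p)) (h := fun p => ract rho (gmap1 (mmul G) p))) => //.
- exact: charted_prod.
- exact: smooth_map_pair.
apply: (smooth_vec_pullback (f := gmap1 (mmul G)) (h := ract rho)) => //.
- exact: charted_prod.
- exact: gmap1_smooth (l2_mul (l2P G)).
- exact: ract_smooth (trepP rho).
Qed.

Lemma shift_is_rep rho g :
  is_rep (@RepData R k G (rspace rho) (fun b => ract rho (b \.h gid g))).
Proof.
split=> [|x|c b cb] /=.
- apply: smooth_ract_mul => //; last exact: smooth_map_cst.
  exact: smooth_map_id (garr_manifold lieG).
- have -> : gid x \.h gid g = gid (x \oh g) :> garr G.
    exact: (gmap_gid (l2_mul (l2P G)) (x, g)).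
  exact: (ract_id (trepP rho)).
- rewrite -(ract_comp (trepP rho)); last first.
    by rewrite /harr (gmap_src (l2_mul (l2P G))) (gmap_tgt (l2_mul (l2P G))) /=
      cb (gsrc_id lieG) (gtgt_id lieG).
  congr (ract rho _).
  have := @gmap_gcomp _ _ _ _ (l2_mul (l2P G)) (c, gid g) (b, gid g).
  rewrite /harr /= => <-; last by rewrite cb (gsrc_id lieG) (gtgt_id lieG).
  have idg : gcomp (gid g) (gid g) = gid g :> garr G.
    by rewrite -{1}(gtgt_id lieG g) (gcomp1l lieG).
  by rewrite /= idg.
Qed.

Definition shift_rep g rho : trivial_rep k G := TrivialRep (shift_is_rep rho g).

Lemma shift_mor_equivariant g rho rho' (f : rep_mor rho rho') :
  (fun x => rmap f (x \oh g)) \in @equivariant R k G (shift_rep g rho) (shift_rep g rho').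
Proof.
have [fs fe] := rep_morP f; rewrite inE; split=> [|b /=].
  apply: (smooth_vec_pullback (N := sprod (gob G) (gob G)) (f := fun x => (x, g))
    (h := fun p => rmap f (gmap0 (mmul G) p))) => //.
  - exact: charted_prod.
  - apply: smooth_map_pair => //; last exact: smooth_map_cst.
    exact: smooth_map_id (gob_manifold lieG).
  apply: (smooth_vec_pullback (f := gmap0 (mmul G)) (h := rmap f)) => //.
    exact: charted_prod.
  exact: gmap0_smooth (l2_mul (l2P G)).
have := fe (b \.h gid g).
rewrite {1 3}/harr (gmap_src (l2_mul (l2P G))) (gmap_tgt (l2_mul (l2P G))) /=.
by rewrite (gsrc_id lieG) (gtgt_id lieG).
Qed.

Definition shift_mor g rho rho' (f : rep_mor rho rho') :
  rep_mor (shift_rep g rho) (shift_rep g rho') :=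
  RepMor (shift_mor_equivariant g f).

Definition shift_functor g : lfunctor (Rep_tr k G) (Rep_tr k G).
Proof.
refine (@LFunctor k (Rep_tr k G) (Rep_tr k G) (shift_rep g)
  (fun rho rho' f => shift_mor g f) _ _ _).
- by move=> rho rho' a f f'; apply/val_inj/funext.
- by move=> rho; apply/val_inj/funext.
- by move=> rho rho' rho'' f' f; apply/val_inj/funext.
Defined.

Lemma shift2_equivariant g g' (a : arrow g g') rho :
  (fun x => ract rho (gid x \.h a)) \in
    @equivariant R k G (shift_rep g rho) (shift_rep g' rho).
Proof.
rewrite inE; split=> [|b /=].
  apply: (@smooth_ract_mul (gob G) rho gid (fun=> arr a)) => //.
    exact: gid_smooth lieG.
  exact: smooth_map_cst.
(* By interchange, both paths around the square are the action of [b \.h a]. *)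
have /(congr1 (fun c : arrow _ _ => ract rho c)) :=
  etrans (arrow_mul_splitr (arrow_of b) a) (esym (arrow_mul_splitl (arrow_of b) a)).
by rewrite !ract_arrow_comp.
Qed.

Definition shift2_mor g g' (a : arrow g g') rho :
  rep_mor (shift_rep g rho) (shift_rep g' rho) :=
  RepMor (shift2_equivariant a rho).

Definition shift2 g g' (a : arrow g g') : lnat (shift_functor g) (shift_functor g').
Proof.
refine (@LNat k _ _ (shift_functor g) (shift_functor g') (shift2_mor a) _).
move=> rho rho' f; apply/val_inj/funext => x /=.
have [_ fe] := rep_morP f; have := fe (arrow_mul (arrow_id x) a).
by rewrite arr_src arr_tgt.
Defined.

Lemma smooth_massoc (W : vectType k) g h (f : garr G -> W) :
  smooth_vec f -> smooth_vec (fun x => f (massoc x g h)).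
Proof.
move=> fs; apply: (@smooth_vec_pullback R k W (gob G)
    (sprod (sprod (gob G) (gob G)) (gob G)) (fun x => ((x, g), h))
    (fun p => f (massoc p.1.1 p.1.2 p.2))) => //.
- by apply: charted_prod => //; exact: charted_prod.
- apply: smooth_map_pair => //; [exact: charted_prod | | exact: smooth_map_cst].
  apply: smooth_map_pair => //; last exact: smooth_map_cst.
  exact: smooth_map_id (gob_manifold lieG).
apply: (@smooth_vec_pullback R k W (sprod (sprod (gob G) (gob G)) (gob G))
    (garr G) (fun p => massoc p.1.1 p.1.2 p.2) f) => //.
- by apply: charted_prod => //; exact: charted_prod.
- exact: gnat_smooth (l2_assoc (l2P G)).
Qed.

Lemma smooth_mrunit (W : vectType k) (f : garr G -> W) :
  smooth_vec f -> smooth_vec (fun x => f (mrunit x)).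
Proof.
apply: (smooth_vec_pullback (f := mrunit)) => //.
exact: gnat_smooth (l2_runit (l2P G)).
Qed.

Lemma smooth_ract_ginv rho : smooth_vec (fun b : garr G => ract rho (ginv b)).
Proof.
apply: (smooth_vec_pullback (f := ginv) (h := ract rho)) => //.
  exact: ginv_smooth lieG.
exact: ract_smooth (trepP rho).
Qed.

Lemma assoc_equivariant g h rho :
  (fun x => ract rho (massoc x g h)) \in
    @equivariant R k G (shift_rep g (shift_rep h rho)) (shift_rep (g \oh h) rho).
Proof.
rewrite inE; split=> [|b /=].
  exact: (@smooth_massoc _ g h (ract rho) (ract_smooth (trepP rho))).
have /(congr1 (fun c : arrow _ _ => ract rho c)) :=
  arrow_assoc_nat (arrow_of b) (arrow_id g) (arrow_id h).
by rewrite !ract_arrow_comp arrow_mul_id.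
Qed.

Definition assoc_mor g h rho :
  rep_mor (shift_rep g (shift_rep h rho)) (shift_rep (g \oh h) rho) :=
  RepMor (assoc_equivariant g h rho).

Definition shift_comp g h :
  lnat (lfunctor_comp (shift_functor g) (shift_functor h)) (shift_functor (g \oh h)).
Proof.
refine (@LNat k _ _ (lfunctor_comp (shift_functor g) (shift_functor h))
  (shift_functor (g \oh h)) (assoc_mor g h) _).
move=> rho rho' f; apply/val_inj/funext => x /=.
have [_ fe] := rep_morP f; have := fe (arrow_assoc x g h).
by rewrite arr_src arr_tgt.
Defined.

Lemma runit_equivariant rho :
  (fun x => ((ract rho (mrunit x))^-1)%VF) \in
    @equivariant R k G rho (shift_rep munit rho).
Proof.
rewrite inE; split=> [|b /=].
  rewrite (_ : (fun x => _) = fun x => ract rho (ginv (mrunit x))); last first.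
    by apply/funext => x; rewrite ract_inv.
  exact: (@smooth_mrunit _ (fun b => ract rho (ginv b)) (@smooth_ract_ginv rho)).
apply: (@ract_inv_square rho rho).
have /(congr1 (fun c : arrow _ _ => ract rho c)) := arrow_runit_nat (arrow_of b).
by rewrite !ract_arrow_comp.
Qed.

Definition runit_mor rho : rep_mor rho (shift_rep munit rho) :=
  RepMor (runit_equivariant rho).

Definition shift_unit : lnat (lfunctor_id (Rep_tr k G)) (shift_functor munit).
Proof.
refine (@LNat k _ _ (lfunctor_id (Rep_tr k G)) (shift_functor munit) runit_mor _).
move=> rho rho' f; apply/val_inj/funext => x /=.
apply: ract_inv_square; have [_ fe] := rep_morP f; have := fe (arrow_runit x).
by rewrite arr_src arr_tgt.
Defined.

(** Equivariance of the pointwise inverse is formal.  Its smoothness could be read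
    off Cramer's rule, but is more direct in the cases at hand, where the inverse
    is the action of a smooth family of arrows. *)
Lemma inverse_equivariant rho rho' (f : rep_mor rho rho')
    (f' : gob G -> 'Hom(rspace rho', rspace rho)) :
  smooth_vec f' -> (forall x, f' x \o rmap f x = \1)%VF ->
  (forall x, rmap f x \o f' x = \1)%VF -> f' \in @equivariant R k G rho' rho.
Proof.
move=> f's f'f ff'; have [_ fe] := rep_morP f; rewrite inE; split=> // b.
rewrite -[in LHS](comp_lfun1r (ract rho' b)) -(ff' (gsrc b)).
by rewrite (comp_lfunA (ract rho' b)) -fe !comp_lfunA f'f comp_lfun1l.
Qed.

Lemma shift_comp_inv g h :
  exists2 a, lnat_vcomp a (shift_comp g h) = lnat_id _ &
             lnat_vcomp (shift_comp g h) a = lnat_id _.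
Proof.
pose inv rho x := ract rho (ginv (massoc x g h)).
have invP rho : inv rho \in
    @equivariant R k G (shift_rep (g \oh h) rho) (shift_rep g (shift_rep h rho)).
  apply: (inverse_equivariant (f := assoc_mor g h rho)) => [|x|x].
  - exact: (@smooth_massoc _ g h (fun b => ract rho (ginv b)) (@smooth_ract_ginv rho)).
  - exact: (ract_ginvK rho (massoc x g h)).
  - exact: (ract_ginvVK rho (massoc x g h)).
apply: (@lnat_invertible k _ _ _ _ (shift_comp g h)
  (fun rho : Rep_tr k G => RepMor (invP rho))) => rho.
  by apply/val_inj/funext => x; exact: (ract_ginvK rho (massoc x g h)).
by apply/val_inj/funext => x; exact: (ract_ginvVK rho (massoc x g h)).
Qed.

Lemma shift_unit_inv :
  exists2 a, lnat_vcomp a shift_unit = lnat_id _ &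
             lnat_vcomp shift_unit a = lnat_id _.
Proof.
have invl rho x : (ract rho (mrunit x) \o (ract rho (mrunit x))^-1 = \1)%VF.
  by rewrite ract_inv; exact: ract_ginvVK.
have invr rho x : ((ract rho (mrunit x))^-1 \o ract rho (mrunit x) = \1)%VF.
  by rewrite ract_inv; exact: ract_ginvK.
have invP rho : (fun x => ract rho (mrunit x)) \in
    @equivariant R k G (shift_rep munit rho) rho.
  apply: (inverse_equivariant (f := runit_mor rho)) => [|x|x].
  - exact: (@smooth_mrunit _ (ract rho) (ract_smooth (trepP rho))).
  - exact: (invl rho x).
  - exact: (invr rho x).
apply: (@lnat_invertible k _ _ _ _ shift_unit
  (fun rho : Rep_tr k G => RepMor (invP rho))) => rho.
  by apply/val_inj/funext => x; exact: (invl rho x).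
by apply/val_inj/funext => x; exact: (invr rho x).
Qed.

(** The definition is transparent, so that the prescribed values of the
    2-representation hold by conversion. *)
Definition shift_two_rep : two_rep G (Rep_tr k G).
Proof.
refine (@Pseudofunctor (delooping G) (TwoVect k) (fun=> Rep_tr k G)
  (fun _ _ => shift_functor) (fun _ _ => shift2)
  (fun _ _ _ => shift_comp) (fun _ => shift_unit)
  _ _ _ _ _ _ _ _).
- move=> ? ? f; apply: lnat_inj => rho; apply/val_inj/funext => x /=.
  by rewrite -(ract_arrow_id rho (x \oh f)) -arrow_mul_id.
- move=> ? ? f g h b a; apply: lnat_inj => rho; apply/val_inj/funext => x /=.
  have /(congr1 (fun c : arrow _ _ => ract rho c)) := arrow_mul_compr x b a.
  by rewrite ract_arrow_comp.
- by move=> ? ? ? g f; exact: shift_comp_inv.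
- by move=> ?; exact: shift_unit_inv.
- move=> ? ? ? g g' f f' b a; apply: lnat_inj => rho; apply/val_inj/funext => x /=.
  have /(congr1 (fun c : arrow _ _ => ract rho c)) :=
    arrow_assoc_nat (arrow_id x) b a.
  rewrite !ract_arrow_comp => /= <-; congr comp_lfun.
  have /(congr1 (fun c : arrow _ _ => ract rho c)) :=
    arrow_mul_splitl (arrow_mul (arrow_id x) b) a.
  by rewrite ract_arrow_comp.
- move=> ? ? ? ? h g f; apply: lnat_inj => rho; apply/val_inj/funext => x /=.
  have /(congr1 (fun c : arrow _ _ => ract rho c)) := arrow_pentagon x h g f.
  by rewrite !ract_arrow_comp !comp_lfun1l !comp_lfun1r => /= <-.
- move=> ? ? f; apply: lnat_inj => rho; apply/val_inj/funext => x /=.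
  have /(congr1 (fun c : arrow _ _ => ract rho c)) := arrow_triangle x f.
  rewrite !ract_arrow_comp /= comp_lfun1r comp_lfunA => ->.
  by rewrite ract_inv ract_ginvVK.
- move=> ? ? f; apply: lnat_inj => rho; apply/val_inj/funext => x /=.
  have /(congr1 (fun c : arrow _ _ => ract rho c)) := arrow_mul_runit x f.
  rewrite !ract_arrow_comp /= comp_lfun1l comp_lfunA => ->.
  by rewrite ract_inv ract_ginvVK.
Defined.

End Translation.

(** * The 2-representation *)

Theorem corollary1 (R : realType) (k : fieldExtType R) (G : lie_2group R) :
  exists P : two_rep G (Rep_tr k G),
    (forall (g : gob G) (rho : trivial_rep k G),
       trep_data (two_rep1 P g rho) =
       RepData (fun b : garr G => ract rho (b \.h gid g))) /\
    (forall (g : gob G) (rho rho' : trivial_rep k G) (f : rep_mor rho rho'),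
       rep_bundle_map (lf1 (two_rep1 P g) f) =
       BundleMap (fun x : gob G => rmap f (x \oh g))) /\
    (forall (g : gob G) (rho rho' : trivial_rep k G) (f : rep_mor rho rho')
       (phi : 'Hom(rspace rho, rspace rho')),
       (forall x : gob G, rmap f x = phi) ->
       rep_bundle_map (lf1 (two_rep1 P g) f) = rep_bundle_map f) /\
    (forall (g0 g0' : gob G) (g1 : arrow g0 g0') (rho : trivial_rep k G),
       rep_bundle_map (two_rep2 P g1 rho) =
       BundleMap (fun x : gob G => ract rho (gid x \.h g1))) /\
    (forall (g h : gob G) (rho : trivial_rep k G),
       rep_bundle_map (two_rep_comp P g h rho) =
       BundleMap (fun x : gob G => ract rho (massoc x g h))) /\
    (forall rho : trivial_rep k G,
       rep_bundle_map (two_rep_unit P rho) =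
       BundleMap (fun x : gob G => ((ract rho (mrunit x))^-1)%VF)).
Proof.
exists (shift_two_rep (k := k) (G := G)); do 5?split=> //.
move=> g rho rho' f phi fE.
have shiftE : (fun x => rmap f (x \oh g)) = rmap f.
  by apply/funext => x; rewrite !fE.
exact: (congr1 (@BundleMap R k G (rspace rho) (rspace rho')) shiftE).
Qed.
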